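(* Let $K$ be a Hausdorff topological space, let $f\colon K\to K$ be a continuous map with a fixed point $x_0\in K$, and let $T\colon X\to X$ be a linearization of $f$ on a topological vector space $X$ (with associated injection $j\colon K\to X$, $j(x_0)=0$). If $f$ has a blow-up/collapse property around $x_0$ with respect to a strictly increasing sequence $(n_k)_k$ of positive integers, then $T$ satisfies the Hypercyclicity Criterion with respect to $(n_k)_k$ and, in particular, $T$ is weakly mixing (respectively, weakly mixing and hypercyclic if $X$ is completely metrizable and separable). Moreover, if $(n_k)_k=(k)_k$, then $T$ is also mixing.
   Context: An operator on a topological vector space is a continuous linear self-map. Linearization: given a continuous map $f\colon W\to W$ on a topological space $W$ with a fixed point $0_W$ (here $W=K$, $0_W=x_0$), a continuous injection $j\colon W\to X$ into a topological vector space $X$, and an operator $T\colon X\to X$, one says that $(X,T)$ is a linearization of $(W,f)$ if $T\circ j=j\circ f$, $j(0_W)=0$, and $\operatorname{span}(j(W))$ is dense in $X$. Blow-up/collapse property: a continuous map $f\colon K\to K$ with $f(x_0)=x_0$ has a blow-up/collapse property around $x_0$ with respect to a strictly increasing sequence $(n_k)_k\in\mathbb N^{\mathbb N}$ if there exist dense subsets $K_0,K_1\subset K$ such that (i) for each $x\in K_0$ there is a sequence $(x_k)_k\in K^{\mathbb N}$ with $\lim_k x_k=x$ and $\lim_k f^{n_k}(x_k)=x_0$; (ii) for each $y\in K_1$ there is a sequence $(y_k)_k\in K^{\mathbb N}$ with $\lim_k y_k=x_0$ and $\lim_k f^{n_k}(y_k)=y$. Hypercyclicity Criterion with respect to $(n_k)_k$: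 there exist dense subsets $X_0,X_1\subset X$ such that (1) for each $x\in X_0$ there is a sequence $(x_k)_k$ in $X$ with $\lim_k x_k=x$ and $\lim_k T^{n_k}x_k=0$; (2) for each $y\in X_1$ there is a sequence $(y_k)_k$ in $X$ with $\lim_k y_k=0$ and $\lim_k T^{n_k}y_k=y$. $T$ is weakly mixing if $T\times T$ is topologically transitive; mixing if for all non-empty open $U,V\subset X$ one has $T^n(U)\cap V\ne\emptyset$ for all sufficiently large $n$; hypercyclic if it has a dense orbit. *)

(* Defs.v *)
From mathcomp Require Import all_boot all_order all_algebra.
From mathcomp Require Import all_classical all_reals all_analysis.

Set Implicit Arguments.
Unset Strict Implicit.
Unset Printing Implicit Defensive.

Import Order.TTheory GRing.Theory Num.Theory.
Import numFieldNormedType.Exports.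

Local Open Scope classical_set_scope.
Local Open Scope ring_scope.

Definition lin_span (F : numFieldType) (X : lmodType F) (A : set X) : set X :=
  [set x | exists (n : nat) (a : 'I_n -> F) (v : 'I_n -> X),
    (forall i, A (v i)) /\ x = \sum_(i < n) a i *: v i].

(* Topological vector spaces are rendered by topologicalLmodType, which, unlike
   the library's tvsType, does not require local convexity. *)
Definition is_linearization (F : numFieldType) (W : topologicalType)
    (X : topologicalLmodType F) (f : W -> W) (w0 : W) (j : W -> X)
    (T : {linear X -> X}) : Prop :=
  [/\ continuous f /\ f w0 = w0,
      continuous T,
      continuous j /\ injective j,
      T \o j = j \o f /\ j w0 = 0 &
      dense (lin_span (range j))].

Definition blowup_collapse (K : topologicalType) (f : K -> K) (x0 : K)
    (n_ : nat -> nat) : Prop :=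
  exists K0 K1 : set K,
    [/\ dense K0, dense K1,
        forall x, K0 x -> exists x_ : nat -> K,
          x_ @ \oo --> x /\ (fun k => iter (n_ k) f (x_ k)) @ \oo --> x0 &
        forall y, K1 y -> exists y_ : nat -> K,
          y_ @ \oo --> x0 /\ (fun k => iter (n_ k) f (y_ k)) @ \oo --> y].

Definition hypercyclicity_criterion (F : numFieldType)
    (X : topologicalLmodType F) (T : {linear X -> X}) (n_ : nat -> nat) : Prop :=
  exists X0 X1 : set X,
    [/\ dense X0, dense X1,
        forall x, X0 x -> exists x_ : nat -> X,
          x_ @ \oo --> x /\
          (fun k => iter (n_ k) T (x_ k)) @ \oo --> (0 : X) &
        forall y, X1 y -> exists y_ : nat -> X,
          y_ @ \oo --> (0 : X) /\
          (fun k => iter (n_ k) T (y_ k)) @ \oo --> y].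

Definition topologically_transitive (S : topologicalType) (f : S -> S) : Prop :=
  forall U V : set S, open U -> U !=set0 -> open V -> V !=set0 ->
    exists n : nat, (iter n f @` U) `&` V !=set0.

Definition weakly_mixing (S : topologicalType) (f : S -> S) : Prop :=
  topologically_transitive (fun p : S * S => (f p.1, f p.2)).

Definition mixing (S : topologicalType) (f : S -> S) : Prop :=
  forall U V : set S, open U -> U !=set0 -> open V -> V !=set0 ->
    exists N : nat, forall n, (N <= n)%N -> (iter n f @` U) `&` V !=set0.

Definition hypercyclic (S : topologicalType) (f : S -> S) : Prop :=
  exists x : S, dense (range (fun n : nat => iter n f x)).

Definition separable (S : topologicalType) : Prop :=
  exists2 A : set S, countable A & dense A.

Definition completely_metrizable (R : realType) (S : topologicalType) : Prop :=
  exists d : S -> S -> R,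
    [/\ (forall x y, d x y = 0 <-> x = y) /\ (forall x y, d x y = d y x),
        forall x y z, d x z <= d x y + d y z,
        forall (x : S) (A : set S),
          nbhs x A <-> exists2 e, 0 < e & [set y | d x y < e] `<=` A &
        forall u : nat -> S,
          (forall e, 0 < e -> exists N : nat, forall m n,
             (N <= m)%N -> (N <= n)%N -> d (u m) (u n) < e) ->
          exists l : S, u @ \oo --> l].

(* Main.v *)
(* Linear combinations of points of j(K0) and j(K1) are dense in X, and since
   T^n (j x) = j (f^n x) and j x0 = 0, the approximating sequences of the
   blow-up/collapse property can be combined linearly into those of the
   Hypercyclicity Criterion.  The criterion makes T^(n_k)(U) meet V for all large
   k, hence simultaneously for two pairs (U, V), which is weak mixing, and for all
   large times when n_k = k.  Hypercyclicity is Birkhoff's transitivity theorem,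
   via Baire's theorem. *)
Require Import Defs.
From mathcomp Require Import all_boot all_order all_algebra.
From mathcomp Require Import all_classical all_reals all_analysis.

Set Implicit Arguments.
Unset Strict Implicit.
Unset Printing Implicit Defensive.

Import Order.TTheory GRing.Theory Num.Theory.
Import numFieldNormedType.Exports.

Local Open Scope classical_set_scope.
Local Open Scope ring_scope.

(** * Linear combinations of points of [j]: limits, density, iterates *)

Lemma cvg_lin_comb (F : numFieldType) (X : topologicalLmodType F) (n : nat)
    (a : 'I_n -> F) (v_ : 'I_n -> nat -> X) (v : 'I_n -> X) :
  (forall i, v_ i @ \oo --> v i) ->
  (fun k => \sum_(i < n) a i *: v_ i k) @ \oo --> \sum_(i < n) a i *: v i.
Proof.
move=> v_cvg; apply: (cvg_big (op := +%R)); first exact: add_continuous.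
move=> i _.
apply: (@continuous2_cvg nat F^o X X \oo _ (fun=> a i) (v_ i)
          (fun b w => b *: w)) => //.
- exact: (@scale_continuous F X (a i, v i)).
- exact: cvg_cst.
Qed.

(** The points [j z] of a combination are moved one at a time to points [j u] with [u] in [A]:
    continuity of the vector operations and of [j] leaves a whole neighbourhood of [z] to choose [u]
    from, and that neighbourhood meets [A]. *)
Lemma dense_lin_span_image (F : numFieldType) (K : topologicalType)
    (X : topologicalLmodType F) (j : K -> X) (A : set K) :
  continuous j -> dense A -> dense (lin_span (range j)) ->
  dense (lin_span (j @` A)).
Proof.
move=> j_cont A_dense span_dense O O0 O_open.
have [x [Ox [n [a [v [jv xE]]]]]] := span_dense O O0 O_open.
(* Openness of [O] is weakened to a neighbourhood condition, because the induction passes to a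
   neighbourhood [Q] of the remaining sum that need not be open. *)
have {}Ox : nbhs (\sum_(i < n) a i *: v i) O.
  by rewrite -xE; exact: open_nbhs_nbhs.
suff [w [Aw Ow]] : exists w : 'I_n -> X,
    (forall i, (j @` A) (w i)) /\ O (\sum_(i < n) a i *: w i).
  by exists (\sum_(i < n) a i *: w i); split=> //; exists n, a, w.
elim: n a v jv O Ox {xE O0 O_open} => [|n IHn] a v jv O.
  rewrite big_ord0 => /nbhs_singleton O0; exists (fun=> 0).
  by split=> [[]//|]; rewrite big_ord0.
rewrite big_ord_recl => Ox.
have [[/= P Q] [nP nQ] PQ] := @add_continuous X (_, _) _ Ox.
have [w [Aw Qw]] := IHn _ _ (fun i => jv (lift ord0 i)) Q nQ.
have [z _ jz] := jv ord0; rewrite -jz in nP.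
have nP' : nbhs (j z) [set y | P (a ord0 *: y)].
  have := @scale_continuous F X (a ord0, j z) _ nP.
  move=> [[/= B C] [nB nC] BC]; apply: filterS nC => y Cy.
  by apply: (BC (a ord0, y)); split=> //; exact: nbhs_singleton.
have nP'' : nbhs z (j @^-1` [set y | P (a ord0 *: y)]) by exact: j_cont.
have [u [/= Pu Au]] : (j @^-1` [set y | P (a ord0 *: y)])^° `&` A !=set0.
  by apply: A_dense; [exists z|exact: open_interior].
(* The new family is [j u] at index [ord0] and [w k] at [lift ord0 k]. *)
exists (fun i => oapp w (j u) (unlift ord0 i)); split=> [i|].
  by case: unliftP => [k|] _ /=; [exact: Aw|exists u].
rewrite big_ord_recl unlift_none /=.
under eq_bigr do rewrite liftK /=.
apply: (PQ (_, _)); split=> //=; exact: (interior_subset Pu).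
Qed.

Lemma linearization_iter (F : numFieldType) (K : topologicalType)
    (X : topologicalLmodType F) (f : K -> K) (j : K -> X) (T : {linear X -> X}) :
  T \o j = j \o f -> forall n x, iter n T (j x) = j (iter n f x).
Proof.
move=> Tj; elim=> // n IHn x; rewrite !iterS IHn.
exact: (congr1 (fun g => g _) Tj).
Qed.

Lemma iter_lin_comb (F : numFieldType) (X : lmodType F) (T : {linear X -> X})
    (m n : nat) (a : 'I_n -> F) (v : 'I_n -> X) :
  iter m T (\sum_(i < n) a i *: v i) = \sum_(i < n) a i *: iter m T (v i).
Proof.
elim: m => // m IHm; rewrite iterS IHm linear_sum.
by apply: eq_bigr => i _; rewrite linearZ.
Qed.

Lemma iter_linearD (F : numFieldType) (X : lmodType F) (T : {linear X -> X})
    (m : nat) (x y : X) :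
  iter m T (x + y) = iter m T x + iter m T y.
Proof. by elim: m => // m IHm; rewrite iterS IHm linearD. Qed.

(* Applied with (g, h) = (id, x0) for the collapse and (x0, id) for the blow-up. *)
Lemma lin_span_lift (F : numFieldType) (K : topologicalType)
    (X : topologicalLmodType F) (f : K -> K) (x0 : K) (j : K -> X)
    (T : {linear X -> X}) (n_ : nat -> nat) (A : set K) (g h : K -> K) :
  is_linearization f x0 j T ->
  (forall x, A x -> exists x_ : nat -> K,
     x_ @ \oo --> g x /\ (fun k => iter (n_ k) f (x_ k)) @ \oo --> h x) ->
  forall (n : nat) (a : 'I_n -> F) (u : 'I_n -> K), (forall i, A (u i)) ->
  exists y_ : nat -> X,
    y_ @ \oo --> \sum_(i < n) a i *: j (g (u i)) /\
    (fun k => iter (n_ k) T (y_ k)) @ \oo --> \sum_(i < n) a i *: j (h (u i)).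
Proof.
move=> [_ _ [j_cont _] [Tj _] _] Alift n a u Au.
have /choice [x_ x_cvg] : forall i, exists x_ : nat -> K, x_ @ \oo --> g (u i) /\
    (fun k => iter (n_ k) f (x_ k)) @ \oo --> h (u i).
  by move=> i; exact: Alift.
exists (fun k => \sum_(i < n) a i *: j (x_ i k)); split.
  apply: (cvg_lin_comb (v_ := fun i k => j (x_ i k))) => i.
  apply: (@continuous_cvg _ _ _ _ _ (x_ i) j); first exact: j_cont.
  exact: (x_cvg i).1.
have -> : (fun k => iter (n_ k) T (\sum_(i < n) a i *: j (x_ i k))) =
    (fun k => \sum_(i < n) a i *: j (iter (n_ k) f (x_ i k))).
  apply/funext => k; rewrite iter_lin_comb.
  by apply: eq_bigr => i _; rewrite (linearization_iter Tj).
apply: (cvg_lin_comb (v_ := fun i k => j (iter (n_ k) f (x_ i k)))) => i.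
apply: (@continuous_cvg _ _ _ _ _ (fun k => iter (n_ k) f (x_ i k)) j).
  exact: j_cont.
exact: (x_cvg i).2.
Qed.

Lemma blowup_collapse_criterion (F : numFieldType) (K : topologicalType)
    (X : topologicalLmodType F) (f : K -> K) (x0 : K) (j : K -> X)
    (T : {linear X -> X}) (n_ : nat -> nat) :
  is_linearization f x0 j T -> blowup_collapse f x0 n_ ->
  hypercyclicity_criterion T n_.
Proof.
move=> linT [K0 [K1 [dK0 dK1 collapse blowup]]].
have [_ _ [j_cont _] [_ jx0] span_dense] := linT.
have preim (A : set K) n (v : 'I_n -> X) : (forall i, (j @` A) (v i)) ->
    exists u : 'I_n -> K, (forall i, A (u i)) /\ v = j \o u.
  move=> jv; have /choice [u uP] : forall i, exists u, A u /\ j u = v i.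
    by move=> i; have [u Au ju] := jv i; exists u.
  exists u; split=> [i|]; first exact: (uP i).1.
  by apply/funext => i /=; rewrite (uP i).2.
(* This sum is the limit of the images in the collapse case and of the starting points in the
   blow-up case. *)
have sum0 n (a : 'I_n -> F) : \sum_(i < n) a i *: j x0 = 0.
  by rewrite big1 // => i _; rewrite jx0 scaler0.
exists (lin_span (j @` K0)), (lin_span (j @` K1)); split.
- exact: dense_lin_span_image.
- exact: dense_lin_span_image.
- move=> _ [n [a [_ [/preim[u [Ku ->]] ->]]]].
  have [y_ []] := lin_span_lift (g := id) (h := fun=> x0) linT collapse a Ku.
  by rewrite /= sum0; exists y_.
- move=> _ [n [a [_ [/preim[u [Ku ->]] ->]]]].
  have [y_ []] := lin_span_lift (g := fun=> x0) (h := id) linT blowup a Ku.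
  by rewrite /= sum0; exists y_.
Qed.

(* If x_k -> u, T^(n_k) x_k -> 0, y_k -> 0 and T^(n_k) y_k -> v, then x_k + y_k
   goes from near u to near v in n_k steps. *)
Lemma criterion_eventually_meets (F : numFieldType) (X : topologicalLmodType F)
    (T : {linear X -> X}) (n_ : nat -> nat) (U V : set X) :
  hypercyclicity_criterion T n_ -> open U -> U !=set0 -> open V -> V !=set0 ->
  \forall k \near \oo, (iter (n_ k) T @` U) `&` V !=set0.
Proof.
move=> [X0 [X1 [dX0 dX1 C0 C1]]] Uo U0 Vo V0.
have [u [Uu /C0[x_ [xu Tx0]]]] := dX0 U U0 Uo.
have [v [Vv /C1[y_ [y0 Tyv]]]] := dX1 V V0 Vo.
have add_cvg (p q : nat -> X) (l m : X) : p @ \oo --> l -> q @ \oo --> m ->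
    (fun k => p k + q k) @ \oo --> l + m.
  apply: (@continuous2_cvg nat X X X \oo _ p q (fun z w => z + w)).
  exact: (@add_continuous X (l, m)).
have nU : \forall k \near \oo, U (x_ k + y_ k).
  have := add_cvg _ _ _ _ xu y0; rewrite addr0; apply.
  exact: open_nbhs_nbhs.
have nV : \forall k \near \oo, V (iter (n_ k) T (x_ k) + iter (n_ k) T (y_ k)).
  have := add_cvg _ _ _ _ Tx0 Tyv; rewrite add0r; apply.
  exact: open_nbhs_nbhs.
apply: filterS2 nU nV => k Uk Vk.
exists (iter (n_ k) T (x_ k + y_ k)); split; first by exists (x_ k + y_ k).
by rewrite iter_linearD.
Qed.

Lemma criterion_weakly_mixing (F : numFieldType) (X : topologicalLmodType F)
    (T : {linear X -> X}) (n_ : nat -> nat) :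
  hypercyclicity_criterion T n_ -> @weakly_mixing X T.
Proof.
move=> crit U V Uo [[u1 u2] Uu] Vo [[v1 v2] Vv].
have [[/= U1 U2] [nU1 nU2] UU] : nbhs (u1, u2) U by exact: open_nbhs_nbhs.
have [[/= V1 V2] [nV1 nV2] VV] : nbhs (v1, v2) V by exact: open_nbhs_nbhs.
have meets (A B : set X) (a b : X) : nbhs a A -> nbhs b B ->
    \forall k \near \oo, (iter (n_ k) T @` A) `&` B !=set0.
  move=> nA nB.
  have := @criterion_eventually_meets _ _ _ _ A^° B^° crit (@open_interior _ _)
    (ex_intro _ a nA) (@open_interior _ _) (ex_intro _ b nB).
  apply: filterS => k [_ [[x Ax <-] Bx]].
  exists (iter (n_ k) T x); split; last exact: interior_subset.
  by exists x => //; exact: interior_subset.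
(* Each pair meets for all large [k], so one [k] serves both coordinates. *)
have [k [[_ [[x Ux <-] Vx]] [_ [[y Uy <-] Vy]]]] : exists k,
    (iter (n_ k) T @` U1) `&` V1 !=set0 /\ (iter (n_ k) T @` U2) `&` V2 !=set0.
  apply: (@filter_ex _ \oo); apply: filterI; [exact: meets nU1 nV1|exact: meets nU2 nV2].
have iterE n : iter n (fun p : X * X => (T p.1, T p.2)) (x, y) =
    (iter n T x, iter n T y).
  by elim: n => // n IHn; rewrite !iterS IHn.
exists (n_ k), (iter (n_ k) T x, iter (n_ k) T y); split; last exact: (VV (_, _) (conj Vx Vy)).
by exists (x, y); [exact: (UU (_, _) (conj Ux Uy))|exact: iterE].
Qed.

Lemma criterion_mixing (F : numFieldType) (X : topologicalLmodType F)
    (T : {linear X -> X}) (n_ : nat -> nat) :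
  (forall k, n_ k = k.+1) -> hypercyclicity_criterion T n_ -> @mixing X T.
Proof.
move=> nE crit U V Uo U0 Vo V0.
have [N _ NP] := criterion_eventually_meets crit Uo U0 Vo V0.
(* Time [n.+1] is [n_ n], so the bound [N] on indices becomes [N.+1] on times. *)
by exists N.+1 => -[//|n] /NP; rewrite /= nE.
Qed.

(** * Birkhoff's transitivity theorem *)

Lemma weakly_mixing_transitive (S : topologicalType) (f : S -> S) :
  weakly_mixing f -> topologically_transitive f.
Proof.
move=> wm U V Uo [u Uu] Vo [v Vv].
(* Transitivity of the product map is tested on cylinders over [U] and [V], then projected to the
   first coordinate. *)
have fst_open (A : set S) : open A -> open [set p : S * S | A p.1].
  by move=> Ao; apply: open_comp Ao => p _; exact: cvg_fst.
have [n [_ [[[x y] /= Ux <-] Vx]]] := wm _ _ (fst_open _ Uo)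
  (ex_intro _ (u, u) Uu) (fst_open _ Vo) (ex_intro _ (v, v) Vv).
have iterE : (iter n (fun p : S * S => (f p.1, f p.2)) (x, y)).1 = iter n f x.
  by elim: n {Vx} => // n IHn; rewrite !iterS /= IHn.
by exists n, (iter n f x); split; [exists x|rewrite -iterE].
Qed.

(** Nested closed balls, the next one inside [O n] with radius at most [n.+1%:R^-1], have centres
    forming a Cauchy sequence whose limit lies in every ball. *)
Lemma completely_metrizable_Baire (R : realType) (S : topologicalType)
    (O : nat -> set S) :
  completely_metrizable R S -> (forall n, open (O n) /\ dense (O n)) ->
  dense (\bigcap_n O n).
Proof.
move=> [d [[d0 dC] dD dN d_complete]] O_od D [z Dz] Do.
have dxx x : d x x = 0 by exact/d0.
have nball x e : 0 < e -> nbhs x [set y | d x y < e].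
  by move=> e0; apply/dN; exists e.
(* Halving the radius makes the closed ball fit in the open one; the minimum with [e] lets the radii
   be forced to 0. *)
have cball x (A : set S) e : 0 < e -> nbhs x A ->
    exists2 r, 0 < r <= e & [set y | d x y <= r] `<=` A.
  move=> e0 /dN[s s0 sA]; exists (Num.min (s / 2) e).
    by rewrite lt_min divr_gt0 //= e0 ge_min lexx orbT.
  move=> y /= /le_lt_trans yr; apply: sA; apply: yr.
  by rewrite gt_min ltr_pdivrMr// ltr_pMr// ltr1n.
pose P n (p q : S * R) := [/\ 0 < q.2, q.2 <= n.+1%:R^-1 &
  [set y | d q.1 y <= q.2] `<=` [set y | d p.1 y <= p.2] `&` O n].
(* The positivity premise makes the step total, as [choice] requires; [(x, r)] is a dummy value for
   nonpositive radii. *)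
have step (np : nat * (S * R)) : exists q, 0 < np.2.2 -> P np.1 np.2 q.
  case: np => n [x r] /=; have [r0|r0] := ltP 0 r; last by exists (x, r).
  have [y [/= By Oy]] : [set y | d x y < r]^° `&` O n !=set0.
    by apply: (O_od n).2; [exists x; exact: nball|exact: open_interior].
  have [] := cball y ([set y | d x y < r] `&` O n) n.+1%:R^-1.
  - by rewrite invr_gt0.
  - by apply: filterI By _; apply: open_nbhs_nbhs; split=> //; exact: (O_od n).1.
  move=> s /andP[s0 sn] sA; exists (y, s) => _; split=> //= w /sA[/= /ltW ? ?].
  by split.
have [r r01 rD] := cball z D 1 ltr01 (open_nbhs_nbhs (conj Do Dz)).
have [g gP] := choice step.
pose c := fix c n := if n is m.+1 then g (m, c m) else (z, r).
have c_gt0 n : 0 < (c n).2.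
  by elim: n => [|n IHn] /=; [case/andP: r01|case: (gP (n, c n) IHn)].
have cP n : P n (c n) (c n.+1) by exact: (gP (n, c n) (c_gt0 n)).
have c_sub n m : (n <= m)%N ->
    [set y | d (c m).1 y <= (c m).2] `<=` [set y | d (c n).1 y <= (c n).2].
  move=> /subnK <-; elim: (m - n)%N => // k IHk y.
  by case: (cP (k + n)%N) => _ _ /[apply] -[+ _]; exact: IHk.
have c_dist n m : (n <= m)%N -> d (c n).1 (c m).1 <= (c n).2.
  by move=> /c_sub; apply; rewrite /= dxx ltW.
have [e e0|l cl] := d_complete (fun n => (c n).1).
  (* All centres from index [N.+1] on lie within [e / 2] of the centre [(c N.+1).1]. *)
  have [N _ /(_ N (leqnn N)) /= Ne] :=
    near_infty_natSinv_lt (PosNum (divr_gt0 e0 (ltr0Sn R 1))).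
  exists N.+1 => m n Nm Nn; have [_ cN _] := cP N.
  rewrite (le_lt_trans (dD _ (c N.+1).1 _))// dC [ltRHS]splitr.
  by rewrite ltrD// (le_lt_trans _ Ne)// (le_trans _ cN)// c_dist.
(* If [l] were outside ball [n], centres close enough to [l] would be outside it too, contradicting
   nestedness. *)
have lc n : d (c n).1 l <= (c n).2.
  rewrite leNgt; apply/negP => ln.
  have /cl[N _ NP] : nbhs l [set y | d l y < d (c n).1 l - (c n).2].
    by apply: nball; rewrite subr_gt0.
  have /= := NP (maxn N n) (leq_maxl _ _).
  apply/negP; rewrite -leNgt lerBlDl (le_trans (dD _ (c (maxn N n)).1 _))//.
  by rewrite [X in _ + X]dC lerD2r c_dist// leq_maxr.
exists l; split; first exact/rD/(lc 0%N).
by move=> n _; have [_ _ /(_ l (lc n.+1))[]] := cP n.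
Qed.

(** Points whose orbit visits a given member of a countable base form an open set, dense by
    transitivity; by Baire some point visits all members. The point [x] records that [S] is
    nonempty. *)
Lemma transitive_hypercyclic (R : realType) (S : topologicalType) (f : S -> S)
    (x : S) :
  continuous f -> completely_metrizable R S -> separable S ->
  topologically_transitive f -> hypercyclic f.
Proof.
move=> f_cont S_cm [A A_countable A_dense] f_trans.
have [d [[d0 _] _ dN _]] := S_cm.
have iter_cont n : continuous (iter n f).
  elim: n => [|n IHn] y; first exact: cvg_id.
  exact: (continuous_comp (IHn y) (f_cont _)).
have [h Ah] : exists h : nat -> S, A `<=` range h.
  have [q] := pcard_leP A_countable.
  (* The enumeration inverts the injection [q] on [A], with default [x] at integers that code no
     point. *)
  exists (fun n => xget x [set a | A a /\ q a = n]) => a Aa.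
  exists (q a) => //; case: xgetP => [b _ [Ab]|/(_ a)[]//].
  by apply: (@inj _ _ A q); rewrite ?inE.
pose B (p : nat * nat) := [set y | d (h p.1) y < p.2.+1%:R^-1 ]^°.
(* Integers that decode to no pair fall back to [(0, 0)], which only repeats a set. *)
pose O n := \bigcup_t (iter t f @^-1` B (odflt (0, 0)%N (unpickle n))).
have Bh p : B p (h p.1).
  by apply/dN; exists p.2.+1%:R^-1; rewrite // invr_gt0.
have O_od n : open (O n) /\ dense (O n).
  split.
    apply: bigcup_open => t _; apply: open_comp; last exact: open_interior.
    by move=> y _; exact: iter_cont.
  move=> D D0 Do; have [t [_ [[y Dy <-] By]]] :=
    f_trans _ _ Do D0 (@open_interior _ _)
      (ex_intro _ _ (Bh (odflt (0, 0)%N (unpickle n)))).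
  by exists y; split=> //; exists t.
have [y [_ Oy]] := completely_metrizable_Baire S_cm O_od
  (ex_intro _ x I : [set: S] !=set0) openT.
exists y => V V0 Vo; have [a [Va Aa]] := A_dense V V0 Vo.
have [n _ hn] := Ah a Aa.
have /dN[e e0 eV] : nbhs a V by exact: open_nbhs_nbhs.
have [m _ /(_ m (leqnn m)) /= me] := near_infty_natSinv_lt (PosNum e0).
have [t _] := Oy (pickle (n, m)) I; rewrite /= pickleK /= => /interior_subset /= ty.
exists (iter t f y); split; last by exists t.
by apply: eV; rewrite /= -hn (lt_trans ty).
Qed.

(* A sequence (n_k)_k of positive integers is indexed by k >= 1; it is encoded
   by n_ : nat -> nat with shifted index, so that (n_k)_k = (k)_k reads
   n_ k = k.+1. *)
Theorem proposition3p5 (R : realType) (F : numFieldType)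
    (K : topologicalType) (f : K -> K) (x0 : K)
    (X : topologicalLmodType F) (j : K -> X) (T : {linear X -> X})
    (n_ : nat -> nat)
    (K_hausdorff : hausdorff_space K)
    (f_continuous : continuous f)
    (f_x0 : f x0 = x0)
    (T_linearization : is_linearization f x0 j T)
    (n_pos : forall k, (0 < n_ k)%N)
    (n_increasing : forall k l, (k < l)%N -> (n_ k < n_ l)%N)
    (f_blowup_collapse : blowup_collapse f x0 n_) :
  [/\ hypercyclicity_criterion T n_,
      @weakly_mixing X T,
      completely_metrizable R X -> separable X -> @hypercyclic X T &
      (forall k, n_ k = k.+1) -> @mixing X T].
Proof.
have crit := blowup_collapse_criterion T_linearization f_blowup_collapse.
have T_wm := criterion_weakly_mixing crit.
have [_ T_continuous _ _ _] := T_linearization.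
split=> // [X_cm X_sep|nE]; last exact: criterion_mixing nE crit.
apply: transitive_hypercyclic X_cm X_sep _ => //; first exact: (0 : X).
exact: weakly_mixing_transitive.
Qed.
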